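(* The coupled Painlevé VI system (S) defined in the context admits extended affine Weyl group symmetry of type $D_6^{(1)}$ as a group of Bäcklund transformations (in the sense made precise in the context), with generators $s_0,\dots,s_6,\pi_1,\pi_2,\pi_3$ given explicitly as follows, where $( * )=(q_1,p_1,q_2,p_2,\eta,t;\alpha_0,\alpha_1,\dots,\alpha_6)$: $$s_0:( * )\to\left(q_1,p_1-\tfrac{\alpha_0}{q_1-t},q_2,p_2,\eta,t;-\alpha_0,\alpha_1,\alpha_2+\alpha_0,\alpha_3,\alpha_4,\alpha_5,\alpha_6\right),$$ $$s_1:( * )\to\left(q_1,p_1-\tfrac{\alpha_1}{q_1-\eta},q_2,p_2,\eta,t;\alpha_0,-\alpha_1,\alpha_2+\alpha_1,\alpha_3,\alpha_4,\alpha_5,\alpha_6\right),$$ $$s_2:( * )\to\left(q_1+\tfrac{\alpha_2}{p_1},p_1,q_2,p_2,\eta,t;\alpha_0+\alpha_2,\alpha_1+\alpha_2,-\alpha_2,\alpha_3+\alpha_2,\alpha_4,\alpha_5,\alpha_6\right),$$ $$s_3:( * )\to\left(q_1,p_1-\tfrac{\alpha_3}{q_1-q_2},q_2,p_2+\tfrac{\alpha_3}{q_1-q_2},\eta,t;\alpha_0,\alpha_1,\alpha_2+\alpha_3,-\alpha_3,\alpha_4+\alpha_3,\alpha_5,\alpha_6\right),$$ $$s_4:( * )\to\left(q_1,p_1,q_2+\tfrac{\alpha_4}{p_2},p_2,\eta,t;\alpha_0,\alpha_1,\alpha_2,\alpha_3+\alpha_4,-\alpha_4,\alpha_5+\alpha_4,\alpha_6+\alpha_4\right),$$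 $$s_5:( * )\to\left(q_1,p_1,q_2,p_2-\tfrac{\alpha_5}{q_2-1},\eta,t;\alpha_0,\alpha_1,\alpha_2,\alpha_3,\alpha_4+\alpha_5,-\alpha_5,\alpha_6\right),$$ $$s_6:( * )\to\left(q_1,p_1,q_2,p_2-\tfrac{\alpha_6}{q_2},\eta,t;\alpha_0,\alpha_1,\alpha_2,\alpha_3,\alpha_4+\alpha_6,\alpha_5,-\alpha_6\right).$$ The transformation $\pi_1$ sends $( * )$ to $(Q_1,P_1,Q_2,P_2,\tfrac1\eta,\tfrac{\eta(t-1)}{t-\eta-\eta t+\eta^2t};\alpha_1,\alpha_0,\alpha_2,\alpha_3,\alpha_4,\alpha_5,\alpha_6)$ with $$Q_1=\frac{(t-1)q_1}{t-q_1-\eta t+\eta tq_1},\quad P_1=\frac{(-t+q_1+\eta t-\eta tq_1)(tp_1-q_1p_1-\alpha_2-\eta tp_1+\eta tq_1p_1+\alpha_2\eta t)}{t(t-1)(\eta-1)},$$ $$Q_2=\frac{(t-1)q_2}{t-q_2-\eta t+\eta tq_2},\quad P_2=\frac{(-t+q_2+\eta t-\eta tq_2)(tp_2-q_2p_2-\alpha_4-\eta tp_2+\eta tq_2p_2+\alpha_4\eta t)}{t(t-1)(\eta-1)}.$$ The transformation $\pi_2$ is $$\pi_2:( * )\to(1-q_1,-p_1,1-q_2,-p_2,1-\eta,1-t;\alpha_0,\alpha_1,\alpha_2,\alpha_3,\alpha_4,\alpha_6,\alpha_5).$$ The transformation $\pi_3$ sends $( * )$ to $(Q_1,P_1,Q_2,P_2,-\tfrac{1}{\eta-1},-\tfrac{(\eta-1)t}{t-\eta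 t+\eta^2(t-1)};\alpha_5,\alpha_6,\alpha_4,\alpha_3,\alpha_2,\alpha_0,\alpha_1)$ with $$Q_1=\frac{t(q_2-\eta)}{t(q_2-\eta)+\eta^2(t-q_2)},\quad P_1=\frac{(t(q_2-\eta)+\eta^2(t-q_2))(t(q_2-\eta)p_2+\alpha_4(t-\eta^2)+\eta^2(t-q_2)p_2)}{t\eta^2(t-\eta)},$$ $$Q_2=\frac{t(q_1-\eta)}{t(q_1-\eta)+\eta^2(t-q_1)},\quad P_2=\frac{(t(q_1-\eta)+\eta^2(t-q_1))(t(q_1-\eta)p_1+\alpha_2(t-\eta^2)+\eta^2(t-q_1)p_1)}{t\eta^2(t-\eta)}.$$
   Context: **The system (S).** Let $\eta\in\mathbb{C}\setminus\{0,1\}$ and let $\alpha_0,\dots,\alpha_6\in\mathbb{C}$ satisfy $\alpha_0+\alpha_1+2(\alpha_2+\alpha_3+\alpha_4)+\alpha_5+\alpha_6=1$. For $\beta_0+\beta_1+2\beta_2+\beta_3+\beta_4=1$ define $H_{VI}(q,p,\eta,t;\beta_0,\dots,\beta_4)$ by $$t(t-1)(t-\eta)H_{VI}=q(q-1)(q-\eta)(q-t)p^2+\{\beta_1(t-\eta)q(q-1)+2\beta_2q(q-1)(q-\eta)+\beta_3(t-1)q(q-\eta)+\beta_4t(q-1)(q-\eta)\}p+\beta_2\{(\beta_1+\beta_2)(t-\eta)+\beta_2(q-1)+\beta_3(t-1)+t\beta_4\}q.$$ The system (S) is the Hamiltonian system $\frac{dq_i}{dt}=\frac{\partial H}{\partial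 p_i}$, $\frac{dp_i}{dt}=-\frac{\partial H}{\partial q_i}$ $(i=1,2)$ with $$H=H_{VI}(q_1,p_1,\eta,t;\alpha_0,\alpha_1,\alpha_2,\alpha_3+2\alpha_4+\alpha_5,\alpha_3+\alpha_6)+H_{VI}(q_2,p_2,\eta,t;\alpha_0+2\alpha_2+\alpha_3,\alpha_1+\alpha_3,\alpha_4,\alpha_5,\alpha_6)+\frac{2(q_1-\eta)q_2\{(q_1-t)p_1+\alpha_2\}\{(q_2-1)p_2+\alpha_4\}}{t(t-1)(t-\eta)}.$$ **Bäcklund transformation.** A transformation $(q_1,p_1,q_2,p_2,\eta,t;\alpha)\mapsto(Q_1,P_1,Q_2,P_2,\eta',t';\alpha')$ as in the claim is a Bäcklund transformation of (S) if, whenever $(q_1,p_1,q_2,p_2)$ is a solution (as functions of $t$) of (S) with parameters $(\eta;\alpha)$ for which the expressions are defined, $(Q_1,P_1,Q_2,P_2)$, regarded as functions of $t'$, is a solution of (S) with independent variable $t'$ and parameters $(\eta';\alpha')$. **Extended affine Weyl group symmetry of type $D_6^{(1)}$.** The Dynkin diagram of type $D_6^{(1)}$ has nodes $0,\dots,6$ and (simple) edges $0$–$2$, $1$–$2$, $2$–$3$, $3$–$4$, $4$–$5$, $4$–$6$. The system has this symmetry with generators $s_i,\pi_j$ if: each $s_i$ and $\pi_j$ is a Bäcklund transformation; the $s_i$ satisfy the defining relations of the affine Weyl group $W(D_6^{(1)})$, namely $s_i^2=1$, $(s_is_j)^2=1$ if $i\ne j$ are not joined by an edge, and $(s_is_j)^3=1$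 if $i,j$ are joined by an edge; and each $\pi_j$ realizes a diagram automorphism $\sigma_j$, i.e. $\pi_js_i=s_{\sigma_j(i)}\pi_j$, where $\sigma_j$ is the permutation of indices by which $\pi_j$ permutes the $\alpha_i$: $\sigma_1=(0\,1)$, $\sigma_2=(5\,6)$, $\sigma_3=(0\,5)(1\,6)(2\,4)$. The equalities are as transformations of rational functions in $(q_1,p_1,q_2,p_2,\eta,t,\alpha)$. *)

(* Defs.v *)
From HB Require Import structures.
From mathcomp Require Import all_boot all_order all_algebra all_fingroup.
From mathcomp Require Import all_classical all_reals all_analysis.
From mathcomp Require Import complex.
From mathcomp Require mpoly.
(* The notations of mpoly clash with those of mathcomp-analysis. *)
Import -(notations) mpoly.

Set Implicit Arguments.
Unset Strict Implicit.
Unset Printing Implicit Defensive.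

Import Order.TTheory GRing.Theory Num.Theory.
Import numFieldNormedType.Exports.

Local Open Scope classical_set_scope.
Local Open Scope ring_scope.

(* (q1, p1, q2, p2, eta, t; alpha_0, ..., alpha_6).  The field F is either the
   field of constants (values of a solution) or a field of rational functions
   (the generic point below). *)
Record point (F : Type) := Point {
  q1 : F; p1 : F; q2 : F; p2 : F; eta : F; time : F;
  a0 : F; a1 : F; a2 : F; a3 : F; a4 : F; a5 : F; a6 : F }.

Definition alpha (F : Type) (x : point F) (i : 'I_7) : F :=
  nth (a0 x) [:: a0 x; a1 x; a2 x; a3 x; a4 x; a5 x; a6 x] i.

(* A rational transformation is given by its formula, which can be evaluated at
   a point over any field; the value is [None] as soon as one of the
   denominators of the formula vanishes. *)
Definition transformation := forall F : fieldType, point F -> option (point F).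

(* [g \after f] first applies f, then g. *)
Definition after (g f : transformation) : transformation :=
  fun F x => obind (@g F) (f F x).

Definition idt : transformation := fun F x => Some x.

Fixpoint power (f : transformation) (n : nat) : transformation :=
  if n is m.+1 then after f (power f m) else idt.

Definition s0 : transformation :=
  fun F '(Point q1 p1 q2 p2 eta t a0 a1 a2 a3 a4 a5 a6) =>
    if q1 - t != 0 then
      Some (Point q1 (p1 - a0 / (q1 - t)) q2 p2 eta t
                  (- a0) a1 (a2 + a0) a3 a4 a5 a6)
    else None.

Definition s1 : transformation :=
  fun F '(Point q1 p1 q2 p2 eta t a0 a1 a2 a3 a4 a5 a6) =>
    if q1 - eta != 0 then
      Some (Point q1 (p1 - a1 / (q1 - eta)) q2 p2 eta t
                  a0 (- a1) (a2 + a1) a3 a4 a5 a6)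
    else None.

Definition s2 : transformation :=
  fun F '(Point q1 p1 q2 p2 eta t a0 a1 a2 a3 a4 a5 a6) =>
    if p1 != 0 then
      Some (Point (q1 + a2 / p1) p1 q2 p2 eta t
                  (a0 + a2) (a1 + a2) (- a2) (a3 + a2) a4 a5 a6)
    else None.

Definition s3 : transformation :=
  fun F '(Point q1 p1 q2 p2 eta t a0 a1 a2 a3 a4 a5 a6) =>
    if q1 - q2 != 0 then
      Some (Point q1 (p1 - a3 / (q1 - q2)) q2 (p2 + a3 / (q1 - q2)) eta t
                  a0 a1 (a2 + a3) (- a3) (a4 + a3) a5 a6)
    else None.

Definition s4 : transformation :=
  fun F '(Point q1 p1 q2 p2 eta t a0 a1 a2 a3 a4 a5 a6) =>
    if p2 != 0 then
      Some (Point q1 p1 (q2 + a4 / p2) p2 eta t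
                  a0 a1 a2 (a3 + a4) (- a4) (a5 + a4) (a6 + a4))
    else None.

Definition s5 : transformation :=
  fun F '(Point q1 p1 q2 p2 eta t a0 a1 a2 a3 a4 a5 a6) =>
    if q2 - 1 != 0 then
      Some (Point q1 p1 q2 (p2 - a5 / (q2 - 1)) eta t
                  a0 a1 a2 a3 (a4 + a5) (- a5) a6)
    else None.

Definition s6 : transformation :=
  fun F '(Point q1 p1 q2 p2 eta t a0 a1 a2 a3 a4 a5 a6) =>
    if q2 != 0 then
      Some (Point q1 p1 q2 (p2 - a6 / q2) eta t
                  a0 a1 a2 a3 (a4 + a6) a5 (- a6))
    else None.

Definition pi1 : transformation :=
  fun F '(Point q1 p1 q2 p2 eta t a0 a1 a2 a3 a4 a5 a6) =>
    if [&& t - q1 - eta * t + eta * t * q1 != 0,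
           t - q2 - eta * t + eta * t * q2 != 0,
           t * (t - 1) * (eta - 1) != 0,
           eta != 0 &
           t - eta - eta * t + eta ^+ 2 * t != 0] then
      Some (Point
        ((t - 1) * q1 / (t - q1 - eta * t + eta * t * q1))
        ((- t + q1 + eta * t - eta * t * q1)
         * (t * p1 - q1 * p1 - a2 - eta * t * p1 + eta * t * q1 * p1
            + a2 * eta * t)
         / (t * (t - 1) * (eta - 1)))
        ((t - 1) * q2 / (t - q2 - eta * t + eta * t * q2))
        ((- t + q2 + eta * t - eta * t * q2)
         * (t * p2 - q2 * p2 - a4 - eta * t * p2 + eta * t * q2 * p2
            + a4 * eta * t)
         / (t * (t - 1) * (eta - 1)))
        (1 / eta)
        (eta * (t - 1) / (t - eta - eta * t + eta ^+ 2 * t))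
        a1 a0 a2 a3 a4 a5 a6)
    else None.

Definition pi2 : transformation :=
  fun F '(Point q1 p1 q2 p2 eta t a0 a1 a2 a3 a4 a5 a6) =>
    Some (Point (1 - q1) (- p1) (1 - q2) (- p2) (1 - eta) (1 - t)
                a0 a1 a2 a3 a4 a6 a5).

Definition pi3 : transformation :=
  fun F '(Point q1 p1 q2 p2 eta t a0 a1 a2 a3 a4 a5 a6) =>
    if [&& t * (q2 - eta) + eta ^+ 2 * (t - q2) != 0,
           t * (q1 - eta) + eta ^+ 2 * (t - q1) != 0,
           t * eta ^+ 2 * (t - eta) != 0,
           eta - 1 != 0 &
           t - eta * t + eta ^+ 2 * (t - 1) != 0] then
      Some (Point
        (t * (q2 - eta) / (t * (q2 - eta) + eta ^+ 2 * (t - q2)))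
        ((t * (q2 - eta) + eta ^+ 2 * (t - q2))
         * (t * (q2 - eta) * p2 + a4 * (t - eta ^+ 2)
            + eta ^+ 2 * (t - q2) * p2)
         / (t * eta ^+ 2 * (t - eta)))
        (t * (q1 - eta) / (t * (q1 - eta) + eta ^+ 2 * (t - q1)))
        ((t * (q1 - eta) + eta ^+ 2 * (t - q1))
         * (t * (q1 - eta) * p1 + a2 * (t - eta ^+ 2)
            + eta ^+ 2 * (t - q1) * p1)
         / (t * eta ^+ 2 * (t - eta)))
        (- (1 / (eta - 1)))
        (- ((eta - 1) * t / (t - eta * t + eta ^+ 2 * (t - 1))))
        a5 a6 a4 a3 a2 a0 a1)
    else None.

Definition s_ (i : 'I_7) : transformation :=
  match val i with
  | 0 => s0 | 1 => s1 | 2 => s2 | 3 => s3 | 4 => s4 | 5 => s5 | _ => s6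
  end.

(* The indices 1, 2, 3 of pi and sigma are shifted to 0, 1, 2 : 'I_3. *)
Definition pi_ (j : 'I_3) : transformation :=
  match val j with 0 => pi1 | 1 => pi2 | _ => pi3 end.

Definition node (k : nat) : 'I_7 := inord k.

Definition sigma (j : 'I_3) : {perm 'I_7} :=
  match val j with
  | 0 => tperm (node 0) (node 1)
  | 1 => tperm (node 5) (node 6)
  | _ => (tperm (node 0) (node 5) * tperm (node 1) (node 6)
          * tperm (node 2) (node 4))%g
  end.

Definition D6_edges : seq (nat * nat) :=
  [:: (0, 2); (1, 2); (2, 3); (3, 4); (4, 5); (4, 6)]%N.

Definition joined (i j : 'I_7) : bool :=
  ((i : nat, j : nat) \in D6_edges) || ((j : nat, i : nat) \in D6_edges).

Section Generic.
Variable K : fieldType.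

(* The rational functions on the space of (q1, p1, q2, p2, eta, t; alpha)
   subject to alpha_0 + alpha_1 + 2 (alpha_2 + alpha_3 + alpha_4) + alpha_5
   + alpha_6 = 1, which has the twelve coordinates q1, p1, q2, p2, eta, t,
   alpha_1, ..., alpha_6. *)
Definition ratfun : fieldType := {fraction (mpoly.mpoly 12 K)}.

Definition coordinate (k : nat) : ratfun :=
  tofrac (mpoly.mpolyX K (mpoly.mnm1 (inord k : 'I_12))).

Definition generic_point : point ratfun :=
  Point (coordinate 0) (coordinate 1) (coordinate 2) (coordinate 3)
        (coordinate 4) (coordinate 5)
        (1 - coordinate 6 - 2 * (coordinate 7 + coordinate 8 + coordinate 9)
         - coordinate 10 - coordinate 11)
        (coordinate 6) (coordinate 7) (coordinate 8) (coordinate 9)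
        (coordinate 10) (coordinate 11).

(* Both transformations make sense as rational maps (no denominator is
   identically zero) and their components are the same rational functions. *)
Definition same_rational (f g : transformation) : Prop :=
  exists y : point ratfun,
    f _ generic_point = Some y /\ g _ generic_point = Some y.

End Generic.

(* H_VI does not involve beta_0 explicitly. *)
Definition H_VI (F : fieldType) (q p eta t b0 b1 b2 b3 b4 : F) : F :=
  (q * (q - 1) * (q - eta) * (q - t) * p ^+ 2
   + (b1 * (t - eta) * q * (q - 1) + 2 * b2 * q * (q - 1) * (q - eta)
      + b3 * (t - 1) * q * (q - eta) + b4 * t * (q - 1) * (q - eta)) * p
   + b2 * ((b1 + b2) * (t - eta) + b2 * (q - 1) + b3 * (t - 1) + t * b4) * q)
  / (t * (t - 1) * (t - eta)).

Definition Ham (F : fieldType) (x : point F) : F :=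
  let: Point q1 p1 q2 p2 eta t a0 a1 a2 a3 a4 a5 a6 := x in
  H_VI q1 p1 eta t a0 a1 a2 (a3 + 2 * a4 + a5) (a3 + a6)
  + H_VI q2 p2 eta t (a0 + 2 * a2 + a3) (a1 + a3) a4 a5 a6
  + 2 * (q1 - eta) * q2 * ((q1 - t) * p1 + a2) * ((q2 - 1) * p2 + a4)
    / (t * (t - 1) * (t - eta)).

Section Solutions.
Variable K : numFieldType.

Record params := Params {
  par_eta : K;
  par0 : K; par1 : K; par2 : K; par3 : K; par4 : K; par5 : K; par6 : K }.

Definition params_of (x : point K) : params :=
  Params (eta x) (a0 x) (a1 x) (a2 x) (a3 x) (a4 x) (a5 x) (a6 x).

Definition at_params (c : params) (x1 y1 x2 y2 t : K) : point K :=
  Point x1 y1 x2 y2 (par_eta c) t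
        (par0 c) (par1 c) (par2 c) (par3 c) (par4 c) (par5 c) (par6 c).

Definition admissible (c : params) : Prop :=
  [/\ par_eta c != 0, par_eta c != 1 &
      par0 c + par1 c + 2 * (par2 c + par3 c + par4 c) + par5 c + par6 c = 1].

(* The four functions solve the system on the open set D of the t-plane.
   is_derive t 1 and 'D_1 refer to differentiation of functions K -> K in the
   sense of K, thus complex differentiation when K = C. *)
Definition solution (c : params) (D : set K) (x1 y1 x2 y2 : K -> K) : Prop :=
  [/\ admissible c, open D &
   forall t, D t ->
     let H u1 v1 u2 v2 := Ham (at_params c u1 v1 u2 v2 t) in
     [/\ t != 0, t != 1 & t != par_eta c] /\
     [/\ is_derive t 1 x1 ('D_1 (fun v => H (x1 t) v (x2 t) (y2 t)) (y1 t)),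
         is_derive t 1 y1 (- 'D_1 (fun u => H u (y1 t) (x2 t) (y2 t)) (x1 t)),
         is_derive t 1 x2 ('D_1 (fun v => H (x1 t) (y1 t) (x2 t) v) (y2 t)) &
         is_derive t 1 y2 (- 'D_1 (fun u => H (x1 t) (y1 t) u (y2 t)) (x2 t))]].

(* Along a solution on D at all points of which f is defined, the new parameters
   c' are constant, the new independent variable t' is a one-to-one function of
   t in D, and Q1, P1, Q2, P2 seen as functions of t' (X1, Y1, X2, Y2 below)
   solve the system with parameters c' on the image of D. *)
Definition backlund (f : transformation) : Prop :=
  forall (c : params) (D : set K) (x1 y1 x2 y2 : K -> K) (z : K -> point K),
    solution c D x1 y1 x2 y2 ->
    (forall t, D t ->
       f K (at_params c (x1 t) (y1 t) (x2 t) (y2 t) t) = Some (z t)) ->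
  exists c' : params,
    [/\ forall t, D t -> params_of (z t) = c',
        forall t u, D t -> D u -> time (z t) = time (z u) -> t = u &
        forall X1 Y1 X2 Y2 : K -> K,
          (forall t, D t ->
             [/\ X1 (time (z t)) = q1 (z t), Y1 (time (z t)) = p1 (z t),
                 X2 (time (z t)) = q2 (z t) & Y2 (time (z t)) = p2 (z t)]) ->
          solution c' [set time (z t) | t in D] X1 Y1 X2 Y2].

Definition D6_symmetry (S : 'I_7 -> transformation) (P : 'I_3 -> transformation)
    (sg : 'I_3 -> {perm 'I_7}) : Prop :=
  [/\ (forall i, backlund (S i)) /\ (forall j, backlund (P j)),
      forall i, same_rational K (power (S i) 2) idt,
      forall i j, i != j -> ~~ joined i j ->
        same_rational K (power (after (S i) (S j)) 2) idt,
      forall i j, joined i j ->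
        same_rational K (power (after (S i) (S j)) 3) idt &
      forall j,
        (forall (F : fieldType) (x y : point F), P j F x = Some y ->
           forall i, alpha y i = alpha x (sg j i)) /\
        (forall i, same_rational K (after (P j) (S i))
                                   (after (S (sg j i)) (P j)))].

End Solutions.

(* Main.v *)
Require Import Defs.
From mathcomp Require Import all_boot all_order all_algebra all_fingroup.
From mathcomp Require Import all_classical all_reals all_analysis complex.
From mathcomp Require Import ring.
From mathcomp Require mpoly.
Import -(notations) mpoly.
(* Required again so that [point] denotes the record of coordinates. *)
Require Import Defs.

(** The statement has an algebraic half, the relations between the generators as
    rational maps, and an analytic half, the fact that each generator carries
    solutions to solutions.

    Relations among the [s_ i].  Put [phi i] for the linear form in the
    denominator of [s_ i].  Then [s_ i] moves the coordinates
    (q1, p1, q2, p2; alpha) along a fixed direction attached to the node i, by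
    the amount alpha_i / phi_i in the canonical variables and by alpha_i in the
    parameters ([reflection], [s_E]).  Such moves ([shift]) add up and commute,
    so a word in two generators s_i, s_j acts by a total displacement along two
    directions.  The displacement depends on x only through phi_i, phi_j,
    alpha_i and alpha_j, because a shift changes [phi] in proportion to the
    Poisson bracket of the two forms (0 for distant nodes, a constant for joined
    ones) and [alpha] in proportion to an entry of the Cartan matrix.  Each Coxeter relation is the vanishing of
    the displacement in this rank two situation ([s_involution], [s_far],
    [s_braid]), and holds at every point of every field at which all the steps
    are defined.

    Relations with the [pi_ j].  Here the 21 identities are between explicit
    rational functions and are checked one at a time ([pi_s]).  The conditions
    under which division is legitimate in the check are, up to nonzero factors,
    the ones under which the two composites are defined.

    Genericity.  To pass from points to rational functions one must know that no
    denominator in a word vanishes identically.  A rational transformation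
    commutes with the specialization of the coordinates at a rational point as
    long as the denominators survive ([regular]).  It is therefore enough to
    evaluate every word at one rational point, [sample], on the hyperplane of
    admissible parameters ([same_rationalP]).

    Backlund property.  Hamilton's equations have explicit right-hand sides
    ([Ham_p1] and its companions, [solutionE]).  In all ten cases the new time
    is a Moebius function of t whose coefficients depend on the parameters only,
    and is invertible; so being a solution in the new time means that the
    derivatives with respect to t are the Hamiltonian vector field at the new
    point multiplied by dt'/dt ([backlund_change_of_time]).  What remains is a
    finite list of identities between rational functions of
    (q1, p1, q2, p2, eta, t; alpha), true on the hyperplane where alpha_0 is
    expressed by the other parameters ([backlund_s], [backlund_pi1],
    [backlund_pi2], [backlund_pi3]). *)

Set Implicit Arguments.
Unset Strict Implicit.
Unset Printing Implicit Defensive.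

Import Order.TTheory GRing.Theory Num.Theory.
Import numFieldNormedType.Exports.

Local Open Scope classical_set_scope.
Local Open Scope ring_scope.

(** * The generators of the Weyl group as shifts *)

Ltac case_node i := case: i => [[|[|[|[|[|[|[|//]]]]]]] ?].

Section Reflections.
Variable F : fieldType.
Implicit Types (x y : point F) (i j : 'I_7) (c d a b : F).

Definition phi i x : F :=
  match val i with
  | 0 => q1 x - time x | 1 => q1 x - eta x | 2 => p1 x | 3 => q1 x - q2 x
  | 4 => p2 x | 5 => q2 x - 1 | _ => q2 x
  end.

(** The displacement c is along the Hamiltonian vector field of [phi i] and the
    displacement a is along minus the i-th row of the affine Cartan matrix.  They
    are independent arguments so that shifts form an additive group action. *)
Definition shift i c a x : point F :=
  let: Point q1 p1 q2 p2 eta t a0 a1 a2 a3 a4 a5 a6 := x in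
  match val i with
  | 0 => Point q1 (p1 - c) q2 p2 eta t
               (a0 - 2 * a) a1 (a2 + a) a3 a4 a5 a6
  | 1 => Point q1 (p1 - c) q2 p2 eta t
               a0 (a1 - 2 * a) (a2 + a) a3 a4 a5 a6
  | 2 => Point (q1 + c) p1 q2 p2 eta t
               (a0 + a) (a1 + a) (a2 - 2 * a) (a3 + a) a4 a5 a6
  | 3 => Point q1 (p1 - c) q2 (p2 + c) eta t
               a0 a1 (a2 + a) (a3 - 2 * a) (a4 + a) a5 a6
  | 4 => Point q1 p1 (q2 + c) p2 eta t
               a0 a1 a2 (a3 + a) (a4 - 2 * a) (a5 + a) (a6 + a)
  | 5 => Point q1 p1 q2 (p2 - c) eta t
               a0 a1 a2 a3 (a4 + a) (a5 - 2 * a) a6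
  | _ => Point q1 p1 q2 (p2 - c) eta t
               a0 a1 a2 a3 (a4 + a) a5 (a6 - 2 * a)
  end.

Definition reflection i x := shift i (alpha x i / phi i x) (alpha x i) x.

Lemma s_E i x : s_ i x = if phi i x != 0 then Some (reflection i x) else None.
Proof.
have N a : a - 2 * a = - a by ring.
case: x => *; case_node i => /=;
  by rewrite /reflection /phi /alpha /shift /= N.
Qed.

Lemma s_Some i x y : s_ i x = Some y -> phi i x != 0 /\ y = reflection i x.
Proof. by rewrite s_E; case: ifP => // nz [<-]. Qed.

Lemma shiftC i j c d a b x :
  shift i c a (shift j d b x) = shift j d b (shift i c a x).
Proof.
case: x => *.
by case_node i; case_node j; rewrite /shift /=; congr Point; ring.
Qed.

Lemma shiftD i c d a b x :
  shift i c a (shift i d b x) = shift i (c + d) (a + b) x.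
Proof. by case: x => *; case_node i; rewrite /shift /=; congr Point; ring. Qed.

Lemma shift_eq0 i c a x : c = 0 -> a = 0 -> shift i c a x = x.
Proof.
move=> -> ->.
by case: x => *; case_node i; rewrite /shift /=; congr Point; ring.
Qed.

Lemma phi_shift i c a x : phi i (shift i c a x) = phi i x.
Proof. by case: x => *; case_node i. Qed.

Lemma alpha_shift i c a x : alpha (shift i c a x) i = alpha x i - 2 * a.
Proof. by case: x => *; case_node i. Qed.

Lemma phi_shift_far i j c a x :
  i != j -> ~~ joined i j -> phi i (shift j c a x) = phi i x.
Proof. by case_node i; case_node j; case: x => *. Qed.

Lemma alpha_shift_far i j c a x :
  i != j -> ~~ joined i j -> alpha (shift j c a x) i = alpha x i.
Proof. by case_node i; case_node j; case: x => *. Qed.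

Lemma alpha_shift_joined i j c a x :
  joined i j -> alpha (shift j c a x) i = alpha x i + a.
Proof. by case_node i; case_node j; case: x => *. Qed.

(** The constant u is the Poisson bracket of the two forms, whence the opposite
    signs. *)
Lemma phi_shift_joined i j : joined i j -> exists u : F,
  (forall c a x, phi i (shift j c a x) = phi i x + u * c) /\
  (forall c a x, phi j (shift i c a x) = phi j x - u * c).
Proof.
by case_node i; case_node j; (try discriminate) => _;
  first [exists 1; split=> c a []*; rewrite /phi /shift /=; ring
       | exists (-1); split=> c a []*; rewrite /phi /shift /=; ring].
Qed.

(** The second step sees the same [phi i] and the opposite [alpha], so it undoes
    the first one. *)
Lemma s_involution i x y : power (s_ i) 2 x = Some y -> y = x.
Proof.
rewrite /power /after /idt /=.
case Ex1: (s_ i x) => [x1|//] /= /s_Some[_ ->].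
have [_ {x1 Ex1}->] := s_Some Ex1.
rewrite /reflection phi_shift alpha_shift shiftD.
by rewrite !shift_eq0 //; ring.
Qed.

Lemma s_far i j x y : i != j -> ~~ joined i j ->
  power (after (s_ i) (s_ j)) 2 x = Some y -> y = x.
Proof.
move=> ij nij; have ji : j != i by rewrite eq_sym.
have nji : ~~ joined j i by rewrite /joined orbC.
rewrite /power /after /idt /=.
case E1: (s_ j x) => [x1|//] /=; case E2: (s_ i x1) => [x2|//] /=.
case E3: (s_ j x2) => [x3|//] /= /s_Some[_ ->].
have [_ {x3 E3}->] := s_Some E3; have [_ {x2 E2}->] := s_Some E2.
have [_ {x1 E1}->] := s_Some E1.
rewrite /reflection.
rewrite !(phi_shift, alpha_shift, phi_shift_far, alpha_shift_far)//.
rewrite [X in shift i _ _ X]shiftC !shiftD.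
by rewrite !shift_eq0 //; ring.
Qed.

(** With f = phi_j and g = phi_i at x, every value of [phi i] and [phi j] along
    the six steps is a quotient of products of f, g, m = fg + ua and n = fg - ub.
    These four quantities are nonzero because each of them is, up to factors
    already known to be nonzero, a denominator met on the way. *)
Lemma s_braid i j x y : joined i j ->
  power (after (s_ i) (s_ j)) 3 x = Some y -> y = x.
Proof.
move=> ij; have ji : joined j i by rewrite /joined orbC.
have [u [phi_i phi_j]] := phi_shift_joined ij.
rewrite /power /after /idt /=.
case E1: (s_ j x) => [x1|//] /=; case E2: (s_ i x1) => [x2|//] /=.
case E3: (s_ j x2) => [x3|//] /=; case E4: (s_ i x3) => [x4|//] /=.
case E5: (s_ j x4) => [x5|//] /=.
move=> /s_Some[].
set f := phi j x; set g := phi i x; set a := alpha x j; set b := alpha x i.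
pose m := f * g + u * a; pose n := f * g - u * b.
have [f0 x1E] := s_Some E1.
rewrite -/f in f0.
have [f1 a1 b1] :
    [/\ phi i x1 = m / f, alpha x1 j = - a & alpha x1 i = a + b].
  rewrite x1E /reflection phi_i alpha_shift alpha_shift_joined//.
  by rewrite -/f -/g -/a -/b; split; [rewrite /m; field|ring|ring].
have g1 : phi j x1 = f by rewrite x1E /reflection phi_shift.
have [m0 x2E] := s_Some E2.
have {}m0 : m != 0 by apply: contraNneq m0 => m0; rewrite f1 m0 mul0r.
have [f2 a2 b2] :
    [/\ phi j x2 = f * n / m, alpha x2 j = b & alpha x2 i = - (a + b)].
  rewrite x2E /reflection phi_j alpha_shift alpha_shift_joined// f1 g1 a1 b1.
  by split; [rewrite /m /n; field; exact/andP|ring|ring].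
have g2 : phi i x2 = m / f by rewrite x2E /reflection phi_shift.
have [n0 x3E] := s_Some E3.
have {}n0 : n != 0 by apply: contraNneq n0 => n0; rewrite f2 n0 mulr0 mul0r.
have [f3 a3 b3] :
    [/\ phi i x3 = g * m / n, alpha x3 j = - b & alpha x3 i = - a].
  rewrite x3E /reflection phi_i alpha_shift alpha_shift_joined// f2 g2 a2 b2.
  by split; [rewrite /n; field; rewrite f0 n0 m0|ring|ring].
have g3 : phi j x3 = f * n / m by rewrite x3E /reflection phi_shift.
have [g0 x4E] := s_Some E4.
have {}g0 : g != 0 by apply: contraNneq g0 => g0; rewrite f3 g0 !mul0r.
have [f4 a4 b4] :
    [/\ phi j x4 = n / g, alpha x4 j = - (a + b) & alpha x4 i = a].
  rewrite x4E /reflection phi_j alpha_shift alpha_shift_joined// f3 g3 a3 b3.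
  by split; [rewrite /m; field; rewrite g0 n0 m0|ring|ring].
have g4 : phi i x4 = g * m / n by rewrite x4E /reflection phi_shift.
have [_ x5E] := s_Some E5.
have [f5 b5] : phi i x5 = g /\ alpha x5 i = - b.
  rewrite x5E /reflection phi_i alpha_shift_joined// f4 g4 a4 b4.
  by split; [rewrite /m /n; field; rewrite g0 n0|ring].
move=> _ ->.
rewrite /reflection f5 b5 {}x5E /reflection f4 a4 {}x4E /reflection f3 b3.
rewrite {}x3E /reflection f2 a2 {}x2E /reflection f1 b1 {}x1E /reflection.
(* Three shifts along i and three along j: collect them direction by direction. *)
rewrite -/f -/a (shiftC j i) !shiftD (shiftC j i) !shiftD.
rewrite !shift_eq0 //; [|ring| |ring].
- by rewrite /m /n; field; rewrite -/m -/n f0 g0 m0 n0.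
- by rewrite /m /n; field; rewrite -/m -/n f0 g0 m0 n0.
Qed.

End Reflections.

(** * The diagram automorphisms *)

Lemma sigmaE (j : 'I_3) (i : 'I_7) :
  val (sigma j i) = nth 0%N (nth [::] [:: [:: 1; 0; 2; 3; 4; 5; 6];
    [:: 0; 1; 2; 3; 4; 6; 5]; [:: 5; 6; 4; 3; 2; 0; 1]] j)%N i.
Proof.
have nodeE k (lt_k7 : (k < 7)%N) : node k = Ordinal lt_k7.
  by apply: val_inj; rewrite /= inordK.
case: j => [[|[|[|//]]] ?]; case_node i;
  by rewrite /sigma /= !nodeE /= ?permM !permE /= ?permE.
Qed.

Lemma pi_alpha (F : fieldType) (j : 'I_3) (x y : point F) :
  pi_ j x = Some y -> forall i, alpha y i = alpha x (sigma j i).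
Proof.
move=> xy i; rewrite /alpha sigmaE; move: xy.
case: j => [[|[|[|//]]] ?]; case_node i;
  by case: x => ? ? ? ? ? ? ? ? ? ? ? ? ?; rewrite /pi_ /=;
    try (case: ifP => // _); case=> <-.
Qed.

Section Nonvanishing.
Variable F : fieldType.
Implicit Types a b k : F.

Lemma mul_neq0E a b : (a * b != 0) = (a != 0) && (b != 0).
Proof. by rewrite mulf_eq0 negb_or. Qed.

Lemma neq0_factor a b k : b = a * k -> b != 0 -> a != 0.
Proof. by move=> ->; rewrite mul_neq0E => /andP[]. Qed.

End Nonvanishing.

Ltac split_neq0 :=
  repeat match goal with
  | H : is_true (_ && _) |- _ => case/andP: H => ? ?
  | H : is_true (_ ^+ 2 != 0) |- _ => rewrite expf_eq0 /= in H
  | H : is_true (_ * _ != 0) |- _ => move: H; rewrite mul_neq0E => /andP[? ?]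
  end.

(** The side conditions left by the field tactic are polynomials; each is, up to
    sign, a polynomial known to be nonzero or the numerator of a difference of
    two fractions known to be nonzero. *)
Ltac neq0 :=
  repeat (apply/andP; split); try assumption;
  match goal with
  | H : is_true (?b != 0) |- is_true (?a != 0) =>
      apply: (neq0_factor (k := 1) _ H); ring
  | H : is_true (?b != 0) |- is_true (?a != 0) =>
      apply: (neq0_factor (k := -1) _ H); ring
  | H : is_true (_ / ?b - _ / ?d != 0) |- is_true (?a != 0) =>
      apply: (neq0_factor (k := (b * d)^-1) _ H); field;
      repeat (apply/andP; split); assumption
  | H : is_true (_ / ?b - - (_ / ?d) != 0) |- is_true (?a != 0) =>
      apply: (neq0_factor (k := (b * d)^-1) _ H); field;
      repeat (apply/andP; split); assumption
  | H : is_true (_ / ?b - 1 != 0) |- is_true (?a != 0) =>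
      apply: (neq0_factor (k := b^-1) _ H); field; assumption
  end.

(** Each [pi_ j] is built from a Moebius map in q that sends 0, 1, eta, t to the
    new 0, 1, eta, t in the order prescribed by [sigma j].  Hence it carries the
    forms [phi i] in q1 and q2 to multiples of one another, and the new p is such
    that a shift of q by alpha / p becomes the shift by alpha over the new p. *)
Lemma pi_s (F : fieldType) (j : 'I_3) (i : 'I_7) (x y y' : point F) :
  after (pi_ j) (s_ i) x = Some y ->
  after (s_ (sigma j i)) (pi_ j) x = Some y' -> y = y'.
Proof.
rewrite /after /s_ /pi_ sigmaE.
case: j => [[|[|[|//]]] ?]; case_node i;
  case: x => Q1 P1 Q2 P2 e t b0 b1 b2 b3 b4 b5 b6 /=;
  repeat (case: ifP => //= ?); case=> <-;
  repeat (case: ifP => //= ?); case=> <-; congr Point.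
all: try ring.
all: try field.
all: split_neq0; neq0.
Qed.

(** * Specialization of the generic point *)

Section Specialization.
Variables (K : numFieldType) (v : 'I_12 -> K).
Implicit Types (r s : rat).

(** The rational function f is regular at v and takes there the rational value
    r.  This is a relation because a value exists only off the polar locus. *)
Definition value_at (f : ratfun K) r := exists a b : mpoly 12 K,
  [/\ f = tofrac a / tofrac b, meval v b != 0
    & meval v a / meval v b = ratr r].

Lemma tofrac_neq0 (b : mpoly 12 K) : meval v b != 0 -> tofrac b != 0.
Proof.
by apply: contraNneq => /eqP; rewrite tofrac_eq0 => /eqP->; rewrite meval0.
Qed.

Lemma value_atD f g r s :
  value_at f r -> value_at g s -> value_at (f + g) (r + s).
Proof.
move=> [a [b [-> b0 rE]]] [c [d [-> d0 sE]]].
exists (a * d + c * b), (b * d); split.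
- by rewrite addf_div ?tofrac_neq0// tofracD !tofracM.
- by rewrite mevalM mulf_neq0.
- by rewrite mevalD !mevalM -addf_div// rE sE rmorphD.
Qed.

Lemma value_atM f g r s :
  value_at f r -> value_at g s -> value_at (f * g) (r * s).
Proof.
move=> [a [b [-> b0 rE]]] [c [d [-> d0 sE]]].
exists (a * c), (b * d); split.
- by rewrite mulf_div !tofracM.
- by rewrite mevalM mulf_neq0.
- by rewrite !mevalM -mulf_div rE sE rmorphM.
Qed.

Lemma value_atN f r : value_at f r -> value_at (- f) (- r).
Proof.
move=> [a [b [-> b0 rE]]]; exists (- a), b; split=> //.
- by rewrite tofracN mulNr.
- by rewrite mevalN mulNr rE rmorphN.
Qed.

Lemma value_at_neq0 f r : value_at f r -> r != 0 -> f != 0.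
Proof.
move=> [a [b [-> b0 rE]]] r0; rewrite mulf_neq0 ?invr_eq0 ?tofrac_neq0//.
have : ratr r != 0 :> K by rewrite fmorph_eq0.
by rewrite -rE; apply: contraNneq => ->; rewrite mul0r.
Qed.

Lemma value_atV f r : r != 0 -> value_at f r -> value_at f^-1 r^-1.
Proof.
move=> r0 [a [b [-> b0 rE]]]; exists b, a; split=> //.
- by rewrite invf_div.
- have : ratr r != 0 :> K by rewrite fmorph_eq0.
  by rewrite -rE; apply: contraNneq => ->; rewrite mul0r.
- by rewrite -invf_div rE; exact/esym/fmorphV.
Qed.

Lemma value_at_nat n : value_at n%:R n%:R.
Proof.
exists n%:R, 1; rewrite !rmorph_nat !rmorph1 !divr1; split=> //.
Qed.

Lemma value_at1 : value_at 1 1.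
Proof. exact: (value_at_nat 1). Qed.

Lemma value_atX f r n : value_at f r -> value_at (f ^+ n) (r ^+ n).
Proof.
move=> fr; elim: n => [|n IHn]; first by rewrite !expr0; exact: value_at1.
by rewrite !exprS; exact: value_atM.
Qed.

End Specialization.

Ltac values :=
  repeat first [assumption | apply: value_atD | apply: value_atN
    | apply: value_atM | apply: value_atV | apply: value_atX
    | exact: value_at1 | exact: value_at_nat].

Section Regularity.
Variables (K : numFieldType) (v : 'I_12 -> K).

Definition values_at (X : point (ratfun K)) (x : point rat) :=
  value_at v (q1 X) (q1 x) /\ value_at v (p1 X) (p1 x) /\
  value_at v (q2 X) (q2 x) /\ value_at v (p2 X) (p2 x) /\
  value_at v (eta X) (eta x) /\ value_at v (time X) (time x) /\
  value_at v (a0 X) (a0 x) /\ value_at v (a1 X) (a1 x) /\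
  value_at v (a2 X) (a2 x) /\ value_at v (a3 X) (a3 x) /\
  value_at v (a4 X) (a4 x) /\ value_at v (a5 X) (a5 x) /\
  value_at v (a6 X) (a6 x).

Definition regular (h : transformation) := forall X x y,
  values_at X x -> h rat x = Some y ->
  exists2 Y, h (ratfun K) X = Some Y & values_at Y y.

Lemma regular_after (g h : transformation) :
  regular g -> regular h -> regular (after g h).
Proof.
move=> rg rh X x z Xx; rewrite /after; case E: (h _ x) => [y|//] /= gy.
by have [Y -> Yy] := rh _ _ _ Xx E; exact: rg gy.
Qed.

Lemma regular_idt : regular idt.
Proof. by move=> X x _ Xx [<-]; exists X. Qed.

Lemma regular_power h n : regular h -> regular (power h n).
Proof.
move=> rh; elim: n => [|n IHn]; first exact: regular_idt.
exact: regular_after.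
Qed.

Lemma regular_s i : regular (s_ i).
Proof.
case=> ? ? ? ? ? ? ? ? ? ? ? ? ? x y.
case: x y => Q1 P1 Q2 P2 e t b0 b1 b2 b3 b4 b5 b6 y.
case; rewrite /= => ?; do 11 (case=> ?); move=> ?.
case_node i; rewrite /s_ /=;
(case: ifPn => // nz [<-]; rewrite ifT;
  [|by apply: (value_at_neq0 (v := v) _ nz); values];
  eexists; [reflexivity|]; do !split; rewrite /=; values).
Qed.

Lemma regular_pi j : regular (pi_ j).
Proof.
case=> ? ? ? ? ? ? ? ? ? ? ? ? ? x y.
case: x y => Q1 P1 Q2 P2 e t b0 b1 b2 b3 b4 b5 b6 y.
case; rewrite /= => ?; do 11 (case=> ?); move=> ?.
case: j => [[|[|[|//]]] ?]; rewrite /pi_ /=.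
2: by case=> <-; eexists; [reflexivity|]; do !split; rewrite /=; values.
all: case: ifP => // /and5P[nz1 nz2 nz3 nz4 nz5] [<-].
all: rewrite ifT; last by apply/and5P; split;
  [apply: (value_at_neq0 (v := v) _ nz1)|apply: (value_at_neq0 (v := v) _ nz2)
  |apply: (value_at_neq0 (v := v) _ nz3)|apply: (value_at_neq0 (v := v) _ nz4)
  |apply: (value_at_neq0 (v := v) _ nz5)]; values.
all: by eexists; [reflexivity|]; do !split; rewrite /=; values.
Qed.

End Regularity.

(** Small integers for which no word of length at most six in the statement
    meets a vanishing denominator; alpha_0 = 1 puts the parameters on the
    hyperplane. *)
Definition sample : point rat := Point 2 1 3 2 5 7 1 0 0 0 0 0 0.

Lemma generic_sample (K : numFieldType) :
  exists v, values_at v (generic_point K) sample.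
Proof.
pose v : 'I_12 -> K :=
  fun i => nth 0 [:: 2; 1; 3; 2; 5; 7; 0; 0; 0; 0; 0; 0] i.
exists v.
have val k r : (k < 12)%N ->
    nth 0 [:: 2; 1; 3; 2; 5; 7; 0; 0; 0; 0; 0; 0] k = ratr r :> K ->
    value_at v (coordinate K k) r.
  move=> lt_k12 rE; exists (mpolyX K (mnm1 (inord k))), 1.
  rewrite tofrac1 divr1 meval1 divr1 mevalXU oner_neq0; split=> //.
  by rewrite /v inordK.
have val0 k : (5 < k < 12)%N -> value_at v (coordinate K k) 0.
  move=> /andP[k5 k12]; apply: val => //; rewrite rmorph0.
  by move: k k5 k12; do 12 (case=> [//|]); case.
have valn k n : (k < 12)%N ->
    nth 0 [:: 2; 1; 3; 2; 5; 7; 0; 0; 0; 0; 0; 0] k = n%:R :> K ->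
    value_at v (coordinate K k) n%:R.
  by move=> ? ?; apply: val => //; rewrite rmorph_nat.
do !split; try exact: valn; try exact: val0; try exact: (valn 1%N 1%N).
(* The coordinate alpha_0 is the expression of the hyperplane. *)
rewrite /= (_ : 1 = 1 - 0 - 2 * (0 + 0 + 0) - 0 - 0 :> rat)//.
by values; exact: val0.
Qed.

Definition defined (f : transformation) := isSome (f rat sample).

Lemma defined_s i : defined (power (s_ i) 2).
Proof. by case_node i; vm_compute. Qed.

Lemma defined_ss2 i j : defined (power (after (s_ i) (s_ j)) 2).
Proof. by case_node i; case_node j; vm_compute. Qed.

Lemma defined_ss3 i j : defined (power (after (s_ i) (s_ j)) 3).
Proof. by case_node i; case_node j; vm_compute. Qed.

Lemma defined_pi_s i j : defined (after (pi_ j) (s_ i)).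
Proof. by case_node i; case: j => [[|[|[|//]]] ?]; vm_compute. Qed.

Lemma defined_s_pi i j : defined (after (s_ (sigma j i)) (pi_ j)).
Proof.
rewrite /s_ sigmaE.
by case_node i; case: j => [[|[|[|//]]] ?]; vm_compute.
Qed.

(** Pointwise agreement over every field includes agreement at the generic
    point, where definedness is inherited from [sample]. *)
Lemma same_rationalP (K : numFieldType) (f g : transformation) :
  (forall v, regular (K := K) v f) -> (forall v, regular (K := K) v g) ->
  defined f -> defined g ->
  (forall (F : fieldType) (x y z : point F),
     f F x = Some y -> g F x = Some z -> y = z) ->
  same_rational K f g.
Proof.
move=> rf rg; rewrite /defined.
case Ef: (f _ _) => [y|//] _; case Eg: (g _ _) => [z|//] _ fg.
have [v Xx] := generic_sample K.
have [Y EY _] := rf _ _ _ _ Xx Ef; have [Z EZ _] := rg _ _ _ _ Xx Eg.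
by exists Y; split=> //; rewrite (fg _ _ _ _ EY EZ).
Qed.

(** * Differentiation over a numerical field *)

(** The rules below are stated for functions written pointwise and give
    derivatives in terms of products, so that they can be chained and the result
    handed to the field tactic. *)
Section Calculus.
Variable K : numFieldType.
Implicit Types (f g : K -> K) (x a b : K).

Lemma is_derive1_cst x a : is_derive x 1 (fun _ : K => a) 0.
Proof. exact: is_derive_cst. Qed.

Lemma is_derive1_id x : is_derive x 1 (fun y : K => y) 1.
Proof. exact: is_derive_id. Qed.

Lemma is_derive1D f g x a b : is_derive x 1 f a -> is_derive x 1 g b ->
  is_derive x 1 (fun y => f y + g y) (a + b).
Proof. exact: is_deriveD. Qed.

Lemma is_derive1N f x a :
  is_derive x 1 f a -> is_derive x 1 (fun y => - f y) (- a).
Proof. exact: is_deriveN. Qed.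

Lemma is_derive1M f g x a b : is_derive x 1 f a -> is_derive x 1 g b ->
  is_derive x 1 (fun y => f y * g y) (a * g x + f x * b).
Proof.
move=> df dg; apply: (is_derive_eq (is_deriveM df dg)).
by rewrite addrC [a * _]mulrC.
Qed.

Lemma is_derive1X f n x a : is_derive x 1 f a ->
  is_derive x 1 (fun y => f y ^+ n) (n%:R * f x ^+ n.-1 * a).
Proof.
move=> df; have -> : (fun y => f y ^+ n) = f ^+ n.
  by apply/funext => y; rewrite exprfctE.
exact: is_deriveX.
Qed.

Lemma is_derive1V f x a : f x != 0 -> is_derive x 1 f a ->
  is_derive x 1 (fun y => (f y)^-1) (- a / f x ^+ 2).
Proof.
move=> fx0 df; have dfx : derivable f x 1 by case: df.
split; first exact: derivableV.
by rewrite deriveV// derive_val mulNr mulrC -[RHS]mulNr.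
Qed.

Lemma is_derive1_chain f g x a b :
  is_derive x 1 f a -> is_derive (f x) 1 g b ->
  is_derive x 1 (fun y => g (f y)) (b * a).
Proof.
case=> /derivable1_diffP df dfx [/derivable1_diffP dg dgx].
split; first by apply/derivable1_diffP; exact: differentiable_comp.
have dgf : differentiable (g \o f) x by exact: differentiable_comp.
rewrite -dfx -dgx -!derive1E derive1E' //.
rewrite diff_comp // !derive1E' //= -[X in 'd  _ _ X = _]mulr1.
by rewrite [LHS]linearZ mulrC.
Qed.

End Calculus.

(** Instance resolution is switched off so that only the rules above apply and
    the derivatives are products rather than scalar multiples. *)
Ltac derive_rules :=
  notypeclasses refine (is_derive_eq _ _);
  [ repeat first [eassumption
    | notypeclasses refine (is_derive1_cst _ _)
    | notypeclasses refine (is_derive1_id _)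
    | notypeclasses refine (is_derive1D _ _)
    | notypeclasses refine (is_derive1N _)
    | notypeclasses refine (is_derive1M _ _)
    | notypeclasses refine (is_derive1X _ _)
    | notypeclasses refine (is_derive1V _ _)] | rewrite /=].

(** * Hamilton's equations *)

Section VectorField.
Variable F : fieldType.

Definition H_VI_p (q p eta t b1 b2 b3 b4 : F) : F :=
  (2 * (q * (q - 1) * (q - eta) * (q - t)) * p
   + b1 * (t - eta) * q * (q - 1) + 2 * b2 * q * (q - 1) * (q - eta)
   + b3 * (t - 1) * q * (q - eta) + b4 * t * (q - 1) * (q - eta))
  / (t * (t - 1) * (t - eta)).

Definition H_VI_q (q p eta t b1 b2 b3 b4 : F) : F :=
  (((q - 1) * (q - eta) * (q - t) + q * (q - eta) * (q - t)
    + q * (q - 1) * (q - t) + q * (q - 1) * (q - eta)) * p ^+ 2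
   + (b1 * (t - eta) * (2 * q - 1)
      + 2 * b2 * ((q - 1) * (q - eta) + q * (q - eta) + q * (q - 1))
      + b3 * (t - 1) * (2 * q - eta) + b4 * t * (2 * q - 1 - eta)) * p
   + b2 * ((b1 + b2) * (t - eta) + b2 * (2 * q - 1) + b3 * (t - 1) + t * b4))
  / (t * (t - 1) * (t - eta)).

Definition Ham_p1 (x : point F) : F :=
  let: Point q1 p1 q2 p2 eta t a0 a1 a2 a3 a4 a5 a6 := x in
  H_VI_p q1 p1 eta t a1 a2 (a3 + 2 * a4 + a5) (a3 + a6)
  + 2 * (q1 - eta) * q2 * (q1 - t) * ((q2 - 1) * p2 + a4)
    / (t * (t - 1) * (t - eta)).

Definition Ham_q1 (x : point F) : F :=
  let: Point q1 p1 q2 p2 eta t a0 a1 a2 a3 a4 a5 a6 := x in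
  H_VI_q q1 p1 eta t a1 a2 (a3 + 2 * a4 + a5) (a3 + a6)
  + 2 * q2 * ((2 * q1 - t - eta) * p1 + a2) * ((q2 - 1) * p2 + a4)
    / (t * (t - 1) * (t - eta)).

Definition Ham_p2 (x : point F) : F :=
  let: Point q1 p1 q2 p2 eta t a0 a1 a2 a3 a4 a5 a6 := x in
  H_VI_p q2 p2 eta t (a1 + a3) a4 a5 a6
  + 2 * (q1 - eta) * q2 * ((q1 - t) * p1 + a2) * (q2 - 1)
    / (t * (t - 1) * (t - eta)).

Definition Ham_q2 (x : point F) : F :=
  let: Point q1 p1 q2 p2 eta t a0 a1 a2 a3 a4 a5 a6 := x in
  H_VI_q q2 p2 eta t (a1 + a3) a4 a5 a6
  + 2 * (q1 - eta) * ((q1 - t) * p1 + a2) * ((2 * q2 - 1) * p2 + a4)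
    / (t * (t - 1) * (t - eta)).

End VectorField.

Section Equations.
Variable K : numFieldType.
Implicit Types (c : params K) (D : set K) (t u v s : K).

Lemma derive_Ham_p1 c u1 v1 u2 v2 t :
  'D_1 (fun v => Ham (at_params c u1 v u2 v2 t)) v1 =
  Ham_p1 (at_params c u1 v1 u2 v2 t).
Proof.
apply: (@derive_val _ _ _ v1 1); rewrite /Ham /H_VI /at_params.
by derive_rules; rewrite /H_VI_p; ring.
Qed.

Lemma derive_Ham_q1 c u1 v1 u2 v2 t :
  'D_1 (fun u => Ham (at_params c u v1 u2 v2 t)) u1 =
  Ham_q1 (at_params c u1 v1 u2 v2 t).
Proof.
apply: (@derive_val _ _ _ u1 1); rewrite /Ham /H_VI /at_params.
by derive_rules; rewrite /H_VI_q; ring.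
Qed.

Lemma derive_Ham_p2 c u1 v1 u2 v2 t :
  'D_1 (fun v => Ham (at_params c u1 v1 u2 v t)) v2 =
  Ham_p2 (at_params c u1 v1 u2 v2 t).
Proof.
apply: (@derive_val _ _ _ v2 1); rewrite /Ham /H_VI /at_params.
by derive_rules; rewrite /H_VI_p; ring.
Qed.

Lemma derive_Ham_q2 c u1 v1 u2 v2 t :
  'D_1 (fun u => Ham (at_params c u1 v1 u v2 t)) u2 =
  Ham_q2 (at_params c u1 v1 u2 v2 t).
Proof.
apply: (@derive_val _ _ _ u2 1); rewrite /Ham /H_VI /at_params.
by derive_rules; rewrite /H_VI_q; ring.
Qed.

Definition regular_time c t := [/\ t != 0, t != 1 & t != par_eta c].

(** The factor r stands for the derivative of the time of the Hamiltonian system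
    with respect to the variable t of the curve. *)
Definition follows (z : K -> point K) (t r : K) :=
  [/\ is_derive t 1 (fun s => q1 (z s)) (r * Ham_p1 (z t)),
      is_derive t 1 (fun s => p1 (z s)) (- (r * Ham_q1 (z t))),
      is_derive t 1 (fun s => q2 (z s)) (r * Ham_p2 (z t)) &
      is_derive t 1 (fun s => p2 (z s)) (- (r * Ham_q2 (z t)))].

Lemma solutionE c D x1 y1 x2 y2 : solution c D x1 y1 x2 y2 <->
  [/\ admissible c, open D & forall t, D t -> regular_time c t /\
    follows (fun s => at_params c (x1 s) (y1 s) (x2 s) (y2 s) s) t 1].
Proof.
rewrite /solution /follows /=.
by split=> -[adm oD sol]; split=> // t /sol; rewrite /regular_time;
  rewrite derive_Ham_p1 derive_Ham_p2 derive_Ham_q1 derive_Ham_q2 !mul1r.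
Qed.

(** Only the germ of the transformed curve at t matters, and there it is given
    by the formula g of the transformation. *)
Lemma follows_formula (f : transformation) (y g z : K -> point K) t r :
  (forall s w, f K (y s) = Some w -> g s = w) ->
  f K (y t) = Some (z t) -> (\near t, f K (y t) = Some (z t)) ->
  follows g t r -> follows z t r.
Proof.
move=> gE /gE gzt nfz; rewrite /follows gzt => -[d1 d2 d3 d4].
by split; [move: d1|move: d2|move: d3|move: d4]; apply: near_eq_is_derive;
  near=> s; congr (_ _); apply: gE; near: s.
Unshelve. all: by end_near. Qed.

(** * Transformations with a Moebius change of time *)

Section ChangeOfTime.
Variables (f : transformation) (c' : params K -> params K).
Variables (A B C E : params K -> K).

Let delta c := A c * E c - B c * C c.

Hypothesis admissible_c' : forall c,
  admissible c -> admissible (c' c) /\ delta c != 0.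

Hypothesis time_f : forall c u1 v1 u2 v2 t (w : point K),
  admissible c -> regular_time c t ->
  @f K (at_params c u1 v1 u2 v2 t) = Some w ->
  [/\ params_of w = c' c, C c * t + E c != 0,
     time w = (A c * t + B c) / (C c * t + E c) & regular_time (c' c) (time w)].

Hypothesis flow_f : forall c x1 y1 x2 y2 (z : K -> point K) t,
  let y s := at_params c (x1 s) (y1 s) (x2 s) (y2 s) s in
  admissible c -> regular_time c t -> follows y t 1 ->
  @f K (y t) = Some (z t) -> (\near t, @f K (y t) = Some (z t)) ->
  follows z t (delta c / (C c * t + E c) ^+ 2).

(** The inverse Moebius map sg recovers t from the new time.  It is continuous,
    so the new times fill an open set, and by the chain rule its derivative
    cancels the factor dt'/dt of the hypothesis on the flow. *)
Lemma backlund_change_of_time : backlund K f.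
Proof.
move=> c D x1 y1 x2 y2 z /solutionE[adm oD sol] fz; exists (c' c).
have [adm' d0] := admissible_c' adm.
have tz t : D t -> [/\ params_of (z t) = c' c, C c * t + E c != 0,
     time (z t) = (A c * t + B c) / (C c * t + E c) &
     regular_time (c' c) (time (z t))].
  by move=> Dt; apply: (time_f adm (sol _ Dt).1 (fz _ Dt)).
pose sg (s : K) := (E c * s - B c) / (A c - C c * s).
have sgden t : D t -> A c - C c * time (z t) = delta c / (C c * t + E c).
  by case/tz => _ n0 -> _; rewrite /delta; field.
have sgK t : D t -> sg (time (z t)) = t.
  move=> Dt; rewrite /sg sgden//; case/tz: Dt => _ n0 -> _.
  by move: d0; rewrite /delta => d0; field; rewrite n0.
have sgdn0 t : D t -> A c - C c * time (z t) != 0.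
  by move=> Dt; rewrite sgden// mulf_neq0// invr_eq0; case/tz: Dt.
have dsg s : A c - C c * s != 0 ->
    is_derive s 1 sg (delta c / (A c - C c * s) ^+ 2).
  move=> n0; rewrite /sg; derive_rules.
  by rewrite /delta; field.
have near_sg t : D t ->
    \forall s \near time (z t), A c - C c * s != 0 /\ D (sg s).
  move=> Dt.
  have csg : {for time (z t), continuous sg}.
    apply/differentiable_continuous/derivable1_diffP.
    by case: (dsg _ (sgdn0 _ Dt)).
  have cden : {for time (z t), continuous (fun s => A c - C c * s)}.
    apply/differentiable_continuous/derivable1_diffP.
    suff [] : is_derive (time (z t)) 1 (fun s => A c - C c * s) (- C c) by [].
    by derive_rules; ring.
  near=> s; split; near: s.
    by apply: cvgr_neq0 cden _; exact: sgdn0.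
  by apply: csg; rewrite sgK//; apply: open_nbhs_nbhs.
have sgV s : A c - C c * s != 0 -> D (sg s) -> time (z (sg s)) = s.
  move=> n0 Ds; have [_ m0 -> _] := tz _ Ds.
  have m0' : C c * (E c * s - B c) + E c * (A c - C c * s) != 0.
    apply: contraNneq d0 => e0; rewrite /delta; apply/eqP.
    by rewrite -e0; ring.
  by rewrite /sg; field; rewrite n0.
split.
- by move=> t /tz[].
- by move=> t u Dt Du tu; rewrite -(sgK t)// tu sgK.
move=> X1 Y1 X2 Y2 XY; apply/solutionE; split=> //.
  rewrite openE => _ [t Dt <-]; rewrite /interior.
  near=> s; have [n0 Ds] : A c - C c * s != 0 /\ D (sg s).
    by near: s; exact: near_sg.
  by exists (sg s) => //; exact: sgV.
move=> _ [t Dt <-]; have [pE n0 tE rt] := tz _ Dt; split=> //.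
have zE : at_params (c' c) (X1 (time (z t))) (Y1 (time (z t)))
    (X2 (time (z t))) (Y2 (time (z t))) (time (z t)) = z t.
  have [-> -> -> ->] := XY _ Dt; rewrite -pE; by case: (z t).
have fl : follows z t (delta c / (C c * t + E c) ^+ 2).
  apply: flow_f => //; [exact: (sol _ Dt).1|exact: (sol _ Dt).2|exact: fz|].
  by near=> s; apply: fz; near: s; exact: open_nbhs_nbhs.
have change (g : K -> K) (X : K -> K) a :
    (forall s, D s -> X (time (z s)) = g s) ->
    is_derive t 1 g (delta c / (C c * t + E c) ^+ 2 * a) ->
    is_derive (time (z t)) 1 X a.
  move=> gX dg; apply: (near_eq_is_derive (f := fun s => g (sg s))).
    near=> s; have [k0 Ds] : A c - C c * s != 0 /\ D (sg s).
      by near: s; exact: near_sg.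
    by rewrite -gX// sgV.
  rewrite -(sgK _ Dt) in dg.
  have := is_derive1_chain (dsg _ (sgdn0 _ Dt)) dg; rewrite sgK//.
  move=> /is_derive_eq; apply; rewrite sgden//; field.
  by rewrite n0.
rewrite /follows zE /=; case: fl => d1 d2 d3 d4; split; rewrite mul1r.
- by apply: change d1 => s /XY[].
- by apply: (change (fun s => p1 (z s))) => [s /XY[]//|]; rewrite mulrN.
- by apply: change d3 => s /XY[].
- by apply: (change (fun s => p2 (z s))) => [s /XY[]//|]; rewrite mulrN.
Unshelve. all: by end_near.
Qed.

End ChangeOfTime.

End Equations.

(** * The generators are Backlund transformations *)

Section Backlund.
Variable K : numFieldType.

Lemma admissible_a0 (c : params K) : admissible c ->
  par0 c = 1 - par1 c - 2 * (par2 c + par3 c + par4 c) - par5 c - par6 c.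
Proof. by case=> _ _ sum1; rewrite -{1}sum1; ring. Qed.

(** The parameters after [s_ i] do not depend on the canonical variables, which
    are set to zero here. *)
Definition params_s (i : 'I_7) (c : params K) : params K :=
  let x := at_params c 0 0 0 0 0 in params_of (shift i 0 (alpha x i) x).

Lemma backlund_s i : backlund K (s_ i).
Proof.
apply: (@backlund_change_of_time _ _ (params_s i)
  (fun=> 1) (fun=> 0) (fun=> 0) (fun=> 1)).
- move=> c adm; rewrite mulr1 mul0r subr0 oner_eq0; split=> //.
  case: c adm => e b0 b1 b2 b3 b4 b5 b6 [/= ? ? sum1].
  by split; case_node i => //; rewrite -[RHS]sum1 /params_s /alpha /=; ring.
- case=> e b0 b1 b2 b3 b4 b5 b6 u1 v1 u2 v2 t w _ rt.
  move=> /s_Some[_ ->]; rewrite mul1r !mul0r addr0 add0r oner_eq0 divr1.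
  by case_node i.
move=> c x1 y1 x2 y2 z t y adm rt fl fz nfz.
apply: (follows_formula (g := fun s => reflection i (y s)) _ fz nfz).
  by move=> s w /s_Some[].
have [nz _] := s_Some fz.
have sum1 := admissible_a0 adm.
rewrite mulr1 !mul0r subr0 add0r expr1n divr1.
case: fl; case: rt => t0; rewrite -subr_eq0 => t1; rewrite -subr_eq0 => te.
move: nz; rewrite /y; clear y fz nfz.
rewrite /= => nz d1 d2 d3 d4.
move: nz; case_node i; rewrite /phi /= => nz.
all: split; rewrite /reflection /phi /alpha /=; derive_rules.
all: rewrite /H_VI_p /H_VI_q ?sum1; field.
all: by rewrite ?t0 ?t1 ?te ?nz.
Qed.

Lemma backlund_pi1 : backlund K pi1.
Proof.
apply: (@backlund_change_of_time _ _
  (fun c => Params (1 / par_eta c) (par1 c) (par0 c) (par2 c) (par3 c) (par4 c)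
              (par5 c) (par6 c))
  (fun c => par_eta c) (fun c => - par_eta c)
  (fun c => 1 - par_eta c + par_eta c ^+ 2) (fun c => - par_eta c)).
- move=> c [e0 e1 sum1]; split.
    split=> /=; first by rewrite mul1r invr_eq0.
      by rewrite mul1r invr_eq1.
    by rewrite -[RHS]sum1; ring.
  have -> : par_eta c * - par_eta c
      - - par_eta c * (1 - par_eta c + par_eta c ^+ 2)
      = par_eta c * (par_eta c - 1) ^+ 2 by ring.
  by rewrite mulf_neq0// expf_neq0// subr_eq0.
- case=> e b0 b1 b2 b3 b4 b5 b6 u1 v1 u2 v2 t w [/= e0 e1 _] [t0 t1 /= te].
  case: ifP => // /and5P[_ _ _ _ den] [<-] /=.
  have denE : (1 - e + e ^+ 2) * t + - e = t - e - e * t + e ^+ 2 * t by ring.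
  rewrite denE; split=> //; first by congr (_ / _); ring.
  rewrite -subr_eq0 in t1; rewrite -subr_eq0 in te; rewrite -subr_eq0 in e1.
  (* The Moebius map sends 1, 0 and eta to 0, 1 and 1/eta. *)
  split; rewrite /=.
  + by rewrite !mulf_neq0// invr_eq0.
  + rewrite -subr_eq0 (_ : _ - 1 =
      - ((e - 1) ^+ 2 * t) / (t - e - e * t + e ^+ 2 * t)).
      by rewrite !(mulf_neq0, oppr_eq0, expf_neq0, invr_eq0).
    by field.
  + rewrite -subr_eq0 (_ : _ - _ =
      (t - e) * (e - 1) / (e * (t - e - e * t + e ^+ 2 * t))).
      by rewrite !(mulf_neq0, invr_eq0).
    by field; neq0.
move=> c x1 y1 x2 y2 z t y adm rt fl fz nfz.
have -> : par_eta c * - par_eta c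
    - - par_eta c * (1 - par_eta c + par_eta c ^+ 2)
    = par_eta c * (par_eta c - 1) ^+ 2 by ring.
have -> : (1 - par_eta c + par_eta c ^+ 2) * t + - par_eta c
    = t - par_eta c - par_eta c * t + par_eta c ^+ 2 * t by ring.
(* The canonical extension to p of the Moebius map with denominator u. *)
pose u q s := s - q - par_eta c * s + par_eta c * s * q.
pose P q p a s := - u q s * (u q s * p + a * (par_eta c * s - 1))
  / (s * (s - 1) * (par_eta c - 1)).
apply: (follows_formula (f := pi1) (g := fun s => Point
    ((s - 1) * x1 s / u (x1 s) s) (P (x1 s) (y1 s) (par2 c) s)
    ((s - 1) * x2 s / u (x2 s) s) (P (x2 s) (y2 s) (par4 c) s)
    (1 / par_eta c)
    (par_eta c * (s - 1) / (s - par_eta c - par_eta c * s + par_eta c ^+ 2 * s))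
    (par1 c) (par0 c) (par2 c) (par3 c) (par4 c) (par5 c) (par6 c)) _ fz nfz).
  move=> s w; rewrite /=; case: ifP => // /and5P[_ _ nz _ _] [<-]; split_neq0.
  by congr Point; rewrite /P /u; field; neq0.
rewrite /P /u.
move: fz; rewrite /=; case: ifP => // /and5P[n1 n2 n3 n4 n5] _.
have sum1 := admissible_a0 adm.
case: fl; case: rt => t0; rewrite -subr_eq0 => t1; rewrite -subr_eq0 => te.
have e1 : par_eta c - 1 != 0 by rewrite subr_eq0; case: adm.
rewrite /y; clear y nfz; rewrite /= => d1 d2 d3 d4.
set e := par_eta c in n1 n2 n3 n4 n5 te e1 d1 d2 d3 d4 *.
(* The differences Q - 1, Q - eta', Q - t' and the factors
   (Q - 1) P + a, (Q - t') P + a of the Hamiltonian are, up to simple factors,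
   the same expressions in other coordinates; rewriting with these formulas
   first makes most of the denominators cancel. *)
pose n := t - e - e * t + e ^+ 2 * t.
have T1 : e * (t - 1) / n - 1 = - ((e - 1) ^+ 2 * t / n) by rewrite /n; field.
have Te : e * (t - 1) / n - 1 / e = (e - 1) * (t - e) / (e * n).
  by rewrite /n; field; neq0.
have Q1 q : t - q - e * t + e * t * q != 0 ->
    (t - 1) * q / (t - q - e * t + e * t * q) - 1
    = - ((e - 1) * t * (q - 1) / (t - q - e * t + e * t * q)).
  by move=> u0; field.
have Qe q : t - q - e * t + e * t * q != 0 ->
    (t - 1) * q / (t - q - e * t + e * t * q) - 1 / e
    = - ((e - 1) * (q - t) / (e * (t - q - e * t + e * t * q))).
  by move=> u0; field; neq0.
have cq q p a : t - q - e * t + e * t * q != 0 ->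
    ((t - 1) * q / (t - q - e * t + e * t * q) - 1)
    * (- (t - q - e * t + e * t * q)
       * ((t - q - e * t + e * t * q) * p + a * (e * t - 1))
       / (t * (t - 1) * (e - 1))) + a
    = (t - q - e * t + e * t * q) * ((q - 1) * p + a) / (t - 1).
  by move=> u0; field; neq0.
have cT q p a : t - q - e * t + e * t * q != 0 ->
    ((t - 1) * q / (t - q - e * t + e * t * q) - e * (t - 1) / n)
    * (- (t - q - e * t + e * t * q)
       * ((t - q - e * t + e * t * q) * p + a * (e * t - 1))
       / (t * (t - 1) * (e - 1))) + a
    = (t - q - e * t + e * t * q) * ((q - e) * p + a) / n.
  by move=> u0; rewrite /n; field; neq0.
have QT q : t - q - e * t + e * t * q != 0 ->
    (t - 1) * q / (t - q - e * t + e * t * q) - e * (t - 1) / n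
    = - ((e - 1) * t * (t - 1) * (q - e) / ((t - q - e * t + e * t * q) * n)).
  by move=> u0; rewrite /n; field; neq0.
split; rewrite /=; derive_rules.
all: rewrite ?/H_VI_p ?/H_VI_q -/n T1 Te ?cq ?cT ?Q1 ?Qe ?QT // ?sum1 /n.
all: field.
all: neq0.
Qed.

Lemma backlund_pi2 : backlund K pi2.
Proof.
apply: (@backlund_change_of_time _ _
  (fun c => Params (1 - par_eta c) (par0 c) (par1 c) (par2 c) (par3 c) (par4 c)
              (par6 c) (par5 c))
  (fun=> -1) (fun=> 1) (fun=> 0) (fun=> 1)).
- move=> c [e0 e1 sum1]; split; last first.
    by rewrite mulr0 subr0 mulr1 oppr_eq0 oner_eq0.
  split=> /=; first by rewrite subr_eq0 eq_sym.
    by rewrite -subr_eq0 addrAC subrr add0r oppr_eq0.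
  by rewrite -[RHS]sum1; ring.
- case=> e b0 b1 b2 b3 b4 b5 b6 u1 v1 u2 v2 t w [/= e0 e1 _] [t0 t1 /= te].
  move=> [<-] /=.
  rewrite mul0r add0r oner_eq0 divr1 mulN1r; split=> //; first by rewrite addrC.
  split; rewrite /=; first by rewrite subr_eq0 eq_sym.
    by rewrite -subr_eq0 addrAC subrr add0r oppr_eq0.
  by rewrite (inj_eq (subrI 1)).
move=> c x1 y1 x2 y2 z t y adm rt fl fz nfz.
apply: (follows_formula (f := pi2) _ fz nfz).
  by move=> s w; rewrite /= => -[<-].
have sum1 := admissible_a0 adm.
case: fl; case: rt => t0; rewrite -subr_eq0 => t1; rewrite -subr_eq0 => te.
rewrite /y; clear y nfz fz; rewrite /= => d1 d2 d3 d4.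
split; rewrite /=; derive_rules.
all: rewrite ?/H_VI_p ?/H_VI_q ?sum1.
all: field.
all: neq0.
Qed.

Lemma backlund_pi3 : backlund K pi3.
Proof.
apply: (@backlund_change_of_time _ _
  (fun c => Params (- (1 / (par_eta c - 1))) (par5 c) (par6 c) (par4 c) (par3 c)
              (par2 c) (par0 c) (par1 c))
  (fun c => - (par_eta c - 1)) (fun=> 0)
  (fun c => 1 - par_eta c + par_eta c ^+ 2) (fun c => - par_eta c ^+ 2)).
- move=> c [e0 e1 sum1]; rewrite -subr_eq0 in e1; split.
    split=> /=; first by rewrite oppr_eq0 mul1r invr_eq0.
      rewrite -subr_eq0 (_ : _ - 1 = - (par_eta c / (par_eta c - 1))).
        by rewrite oppr_eq0 mulf_neq0// invr_eq0.
      by field.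
    by rewrite -[RHS]sum1; ring.
  by rewrite mul0r subr0 mulrNN mulf_neq0// expf_neq0.
- case=> e b0 b1 b2 b3 b4 b5 b6 u1 v1 u2 v2 t w [/= e0 e1 _] [t0 t1 /= te].
  case: ifP => // /and5P[_ _ _ _ den] [<-] /=.
  have denE : (1 - e + e ^+ 2) * t + - e ^+ 2
      = t - e * t + e ^+ 2 * (t - 1) by ring.
  rewrite denE; split=> //; first by rewrite addr0 !mulNr.
  rewrite -subr_eq0 in t1; rewrite -subr_eq0 in te; rewrite -subr_eq0 in e1.
  (* The Moebius map sends 0, 1 and eta to 0, 1 and -1/(eta - 1). *)
  split; rewrite /=.
  + by rewrite oppr_eq0 !mulf_neq0// invr_eq0.
  + rewrite -subr_eq0 (_ : _ - 1 =
      - (e ^+ 2 * (t - 1)) / (t - e * t + e ^+ 2 * (t - 1))).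
      by rewrite !(mulf_neq0, oppr_eq0, expf_neq0, invr_eq0).
    by field.
  + rewrite -subr_eq0 (_ : _ - _ =
      e * (t - e) / ((e - 1) * (t - e * t + e ^+ 2 * (t - 1)))).
      by rewrite !(mulf_neq0, invr_eq0).
    by field; neq0.
move=> c x1 y1 x2 y2 z t y adm rt fl fz nfz.
apply: (follows_formula (f := pi3) _ fz nfz).
  by move=> s w; rewrite /=; case: ifP => // _ [<-].
move: fz; rewrite /=; case: ifP => // /and5P[n1 n2 n3 n4 n5] _.
have sum1 := admissible_a0 adm.
case: fl; case: rt => t0; rewrite -subr_eq0 => t1; rewrite -subr_eq0 => te.
have e0 : par_eta c != 0 by case: adm.
(* The numerators of t' - eta' and t' - 1 occur in the denominators. *)
have m1 : par_eta c * (t - par_eta c) != 0 by exact: mulf_neq0.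
have m2 : par_eta c ^+ 2 * (t - 1) != 0 by rewrite mulf_neq0// expf_neq0.
rewrite /y; clear y nfz; rewrite /= => d1 d2 d3 d4.
split; rewrite /=; derive_rules.
all: rewrite ?/H_VI_p ?/H_VI_q ?sum1.
all: field.
all: neq0.
Qed.

End Backlund.

(** * The symmetry *)

Theorem theorem2p1 (R : realType) : D6_symmetry R[i]%C s_ pi_ sigma.
Proof.
have idP f : (forall v, regular (K := R[i]%C) v f) -> defined f ->
    (forall (F : fieldType) (x y : point F), f F x = Some y -> y = x) ->
    same_rational R[i]%C f idt.
  move=> rf df fid; apply: same_rationalP => //.
  - by move=> v; exact: regular_idt.
  - by move=> F x y z /fid -> [].
split.
- split=> [i|j]; first exact: backlund_s.
  case: j => [[|[|[|//]]] ?]; [exact: backlund_pi1|exact: backlund_pi2|].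
  exact: backlund_pi3.
- move=> i; apply: idP; last by move=> F x y; exact: s_involution.
    by move=> v; apply/regular_power/regular_s.
  exact: defined_s.
- move=> i j ij nij; apply: idP; last by move=> F x y; exact: s_far.
    by move=> v; apply/regular_power/regular_after; exact: regular_s.
  exact: defined_ss2.
- move=> i j ij; apply: idP; last by move=> F x y; exact: s_braid.
    by move=> v; apply/regular_power/regular_after; exact: regular_s.
  exact: defined_ss3.
- move=> j; split=> [F x y|i]; first exact: pi_alpha.
  apply: same_rationalP.
  + by move=> v; apply: regular_after; [exact: regular_pi|exact: regular_s].
  + by move=> v; apply: regular_after; [exact: regular_s|exact: regular_pi].
  + exact: defined_pi_s.
  + exact: defined_s_pi.
  + by move=> F x y z; exact: pi_s.
Qed.
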